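(* Let $I$ be an admissible ideal of $\mathbb{N}$ and let $A_I$ be the ring of all $I$-convergent sequences of real numbers (with termwise addition and multiplication). Then $A_I$ is a transitional ring.
   Context: An ideal $I$ of $\mathbb{N}$ is a nonempty family of subsets of $\mathbb{N}$ closed under subsets and finite unions; it is nontrivial if $\mathbb{N}\notin I$; it is admissible if it is nontrivial and contains all finite subsets of $\mathbb{N}$. A real sequence $(x_n)_{n\ge1}$ is $I$-convergent to $x\in\mathbb{R}$ (written $I\text{-}\lim x_n=x$) if $\{n\in\mathbb{N}\mid |x_n-x|\ge\epsilon\}\in I$ for every $\epsilon>0$; it is $I$-convergent if it is $I$-convergent to some real number. All rings are commutative with unity. $\mathcal{P}(\Lambda)$ is the power set of $\Lambda$. For a ring $A$ and a nonempty set $\Lambda$, a map $\psi:A\to\mathcal{P}(\Lambda)$ is a semi-transition map on $A$ if: (i) $\psi(ab)=\psi(a)\cup\psi(b)$ for all $a,b\in A$; (ii) $\psi(1)=\emptyset$, and $\psi(a)=\Lambda$ if and only if $a=0$; (iii) for all $a,b\in A$ there is some $c$ in the ideal $(a,b)$ with $\psi(a)\cap\psi(b)=\psi(c)\subseteq\psi(a+b)$; moreover, if $\psi(a)\cap\psi(b)=\emptyset$, then the ideal $(a^m,b^n)$ is principal for some $m,n\in\mathbb{N}$ (positive integers). A pm-ring is a ring in which each prime ideal is contained in a unique maximal ideal. A transition map on $A$ is a semi-transition map $\psi:A\to\mathcal{P}(\Lambda)$, where $A$ is a pm-ring, such that: (T1) if $\lambda_1\neq\lambda_2$ in $\Lambda$,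 then there is $a\in A$ such that $\psi(a)$ contains exactly one of $\lambda_1,\lambda_2$; (T2) for all $\lambda\in\Lambda$ and $a\in A$ with $\lambda\notin\psi(a)$, there is $b\in A$ with $\lambda\in\psi(b)$ and $\psi(a)\cap\psi(b)=\emptyset$. A ring is transitional if it is a pm-ring admitting a transition map. *)

(* Defs.v *)
From HB Require Import structures.
From mathcomp Require Import all_boot all_order all_algebra.
From mathcomp Require Import ring_quotient ring.
From mathcomp Require Import all_classical all_reals.

Set Implicit Arguments.
Unset Strict Implicit.
Unset Printing Implicit Defensive.

Import Order.TTheory GRing.Theory Num.Theory.

Local Open Scope classical_set_scope.
Local Open Scope ring_scope.

(** * Transitional rings *)

(* Excluding the zero ring loses nothing: there, [psi 1 = set0] and
   [psi 0 = setT] would contradict the nonemptiness of the target set. *)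
Section Rings.
Variable A : comNzRingType.

(* Ring ideals are boolean predicates, as in [ring_quotient]; classically these
   are all the subsets of [A].  [idealr_closed] requires [1 \notin P], so it
   describes the proper ideals. *)
Definition prime_ideal (P : {pred A}) : Prop :=
  idealr_closed P /\ prime_idealr_closed P.

Definition maximal_ideal (M : {pred A}) : Prop :=
  idealr_closed M /\
  forall J : {pred A}, idealr_closed J -> {subset M <= J} -> J =i M.

Definition pm_ring : Prop :=
  forall P : {pred A}, prime_ideal P ->
    exists! M : {pred A}, maximal_ideal M /\ {subset P <= M}.

Definition ideal2 (a b : A) : set A := [set x | exists u v, x = u * a + v * b].

Definition principal (J : set A) : Prop :=
  exists c : A, J = [set u * c | u in [set: A]].

Record semi_transition_map (L : Type) (psi : A -> set L) : Prop := {
  semi_transition_nonempty : [set: L] !=set0;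
  semi_transitionM : forall a b, psi (a * b) = psi a `|` psi b;
  semi_transition1 : psi 1 = set0;
  semi_transitionT : forall a, psi a = setT <-> a = 0;
  semi_transitionI : forall a b, exists c,
    [/\ ideal2 a b c, psi a `&` psi b = psi c & psi c `<=` psi (a + b)];
  semi_transition_principal : forall a b, psi a `&` psi b = set0 ->
    exists m n : nat,
      [/\ (0 < m)%N, (0 < n)%N & principal (ideal2 (a ^+ m) (b ^+ n))]
}.

Record transition_map (L : Type) (psi : A -> set L) : Prop := {
  transition_pm : pm_ring;
  transition_semi : semi_transition_map psi;
  transition_T1 : forall l1 l2 : L, l1 <> l2 -> exists a,
    (psi a l1 /\ ~ psi a l2) \/ (~ psi a l1 /\ psi a l2);
  transition_T2 : forall (l : L) a, ~ psi a l -> exists b,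
    psi b l /\ psi a `&` psi b = set0
}.

Definition transitional : Prop :=
  pm_ring /\ exists (L : Type) (psi : A -> set L), transition_map psi.

End Rings.

(** * The ring of I-convergent sequences *)

Record set_ideal (T : Type) (I : set_system T) : Prop := {
  set_ideal_nonempty : I !=set0;
  set_idealS : forall X Y : set T, X `<=` Y -> I Y -> I X;
  set_idealU : setU_closed I
}.

(* A sequence (x_n) with n >= 1 is represented by [fun k => x_(k+1)], and
   accordingly subsets of {1, 2, ...} by subsets of [nat]. *)
Record admissible (I : set_system nat) : Prop := {
  admissible_ideal : set_ideal I;
  admissible_nontrivial : ~ I setT;
  admissible_finite : forall F : set nat, finite_set F -> I F
}.

Section IdealConvergence.
Variables (R : realType) (I : set_system nat).

Definition ideal_cvg_to (x : nat -> R) (l : R) : Prop :=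
  forall e : R, 0 < e -> I [set n | e <= `|x n - l|].

Definition ideal_cvg (x : nat -> R) : Prop := exists l : R, ideal_cvg_to x l.

Definition ideal_cvg_pred : {pred nat -> R} := fun x => `[< ideal_cvg x >].

Hypothesis admI : admissible I.

Let idealS := set_idealS (admissible_ideal admI).
Let idealU := set_idealU (admissible_ideal admI).

Lemma ideal_cvg_subring : subring_closed ideal_cvg_pred.
Proof.
split=> [|x y|x y].
- apply/asboolP; exists 1 => e e0.
  have -> : [set n | e <= `|(1 : nat -> R) n - 1|] = set0.
    by apply/seteqP; split=> n //=; rewrite subrr normr0 leNgt e0.
  exact: (admissible_finite admI) (finite_set0 _).
- move=> /asboolP[l xl] /asboolP[m ym]; apply/asboolP; exists (l - m) => e e0.
  have e2 : 0 < e / 2 by rewrite divr_gt0.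
  apply: idealS (idealU (xl _ e2) (ym _ e2)) => n /=.
  have [xe|xe] := leP (e / 2) `|x n - l|; first by left.
  have [ye|ye] := leP (e / 2) `|y n - m|; first by right.
  rewrite leNgt => /negP[].
  have -> : (x - y) n - (l - m) = (x n - l) - (y n - m).
    by have -> : (x - y) n = x n - y n by []; ring.
  by rewrite (le_lt_trans (ler_normB _ _))// (splitr e) ltrD.
- move=> /asboolP[l xl] /asboolP[m ym]; apply/asboolP; exists (l * m) => e e0.
  pose K := 1 + `|l| + `|m|.
  have K0 : 0 < K by rewrite !ltr_pwDl.
  pose d := Num.min 1 (e / K).
  have d0 : 0 < d by rewrite lt_min ltr01 divr_gt0.
  have d1 : d <= 1 by rewrite ge_min lexx.
  have dK : d * K <= e by rewrite -ler_pdivlMr// ge_min lexx orbT.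
  apply: idealS (idealU (xl _ d0) (ym _ d0)) => n /=.
  have [xe|xe] := leP d `|x n - l|; first by left.
  have [ye|ye] := leP d `|y n - m|; first by right.
  rewrite leNgt => /negP[]; apply: lt_le_trans dK.
  have -> : (x * y) n - l * m =
      (x n - l) * (y n - m) + l * (y n - m) + m * (x n - l).
    by have -> : (x * y) n = x n * y n by []; ring.
  have -> : d * K = d + `|l| * d + `|m| * d by rewrite /K; ring.
  apply: le_lt_trans (ler_normD _ _) _; rewrite ltr_leD//; last first.
    by rewrite normrM ler_wpM2l// ltW.
  apply: le_lt_trans (ler_normD _ _) _; rewrite ltr_leD//; last first.
    by rewrite normrM ler_wpM2l// ltW.
  rewrite normrM; apply: le_lt_trans xe.
  by rewrite ler_piMr// (le_trans (ltW ye)).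
Qed.

End IdealConvergence.

(* Admissibility is an argument of the type because its ring structure relies
   on it. *)
Record ideal_cvg_seq (R : realType) (I : set_system nat) (admI : admissible I) :=
  IdealCvgSeq {
    ideal_cvg_val :> nat -> R;
    _ : ideal_cvg_val \in ideal_cvg_pred I
  }.

Section IdealCvgRing.
Variables (R : realType) (I : set_system nat) (admI : admissible I).

Local Notation A := (ideal_cvg_seq R admI).

HB.instance Definition _ := [isSub for @ideal_cvg_val R I admI].
HB.instance Definition _ := [Choice of A by <:].
HB.instance Definition _ := GRing.SubChoice_isSubComNzRing.Build
  (nat -> R) (ideal_cvg_pred I) A (ideal_cvg_subring R admI).

Lemma ideal_cvg_seqD (x y : A) n : (x + y) n = x n + y n.
Proof. by []. Qed.

Lemma ideal_cvg_seqM (x y : A) n : (x * y) n = x n * y n.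
Proof. by []. Qed.

Lemma ideal_cvg_seq1 n : (1 : A) n = 1.
Proof. by []. Qed.

End IdealCvgRing.

(* Main.v *)
(** Contessa's criterion: a ring in which [a + b = 1] always yields [r], [s] with
    [(1 - r a)(1 - s b) = 0] is a pm-ring, the maximal ideal over a prime [P] being
    the set of those [a] such that no [1 - r a] lies in [P].  In the ring of
    I-convergent sequences, one of [a], [b] has a nonzero limit, say [a]; its
    pointwise inverse [r], completed by 0 at the zeros of [a], is again
    I-convergent, and [s = 1 - r a] works.

    The transition map sends [a] to its zero set in the one-point extension of the
    index set, the extra point belonging to it when [a] I-converges to 0.  If
    [psi a] and [psi b] are disjoint then [a^2 + b^2] has neither a zero nor the
    limit 0, so it is a unit. *)
Require Import Defs.
From mathcomp Require Import all_boot all_order all_algebra.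
From mathcomp Require Import ring_quotient ring.
From mathcomp Require Import all_classical all_reals.
From mathcomp Require Import topology normedtype.

Set Implicit Arguments.
Unset Strict Implicit.
Unset Printing Implicit Defensive.

Import Order.TTheory GRing.Theory Num.Theory.
Import numFieldNormedType.Exports.

Local Open Scope classical_set_scope.
Local Open Scope ring_scope.

(** * Proper ideals and Contessa's criterion *)

Section Ideals.
Variables (A : comNzRingType) (J : {pred A}).
Hypothesis idJ : idealr_closed J.

Let J1 : 1 \notin J. Proof. by case: idJ. Qed.

Lemma idealr_closedMl (r x : A) : x \in J -> r * x \in J.
Proof. by case: idJ => J0 _ JM xJ; rewrite -[_ * _]addr0 JM. Qed.

Lemma idealr_closedD (x y : A) : x \in J -> y \in J -> x + y \in J.
Proof. by case: idJ => _ _ JM xJ yJ; rewrite -[x]mul1r JM. Qed.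

Lemma idealr_closed_sub1F (r x : A) : x \in J -> 1 - r * x \in J -> False.
Proof.
move=> xJ xJ1; move/negP: J1; apply.
by rewrite -(subrK (r * x) 1) idealr_closedD// idealr_closedMl.
Qed.

End Ideals.

Section Contessa.
Variable A : comNzRingType.
Hypothesis contessa :
  forall a b : A, a + b = 1 -> exists r s, (1 - r * a) * (1 - s * b) = 0.

Lemma contessa_pm_ring : pm_ring A.
Proof.
move=> P [Pideal primeP].
pose M : {pred A} := fun a => `[< forall r, 1 - r * a \notin P >].
have MP a : reflect (forall r, 1 - r * a \notin P) (a \in M) by exact: asboolP.
have PM : {subset P <= M}.
  by move=> a aP; apply/MP => r; apply/negP => /(idealr_closed_sub1F Pideal aP).
have MZ x a : a \in M -> x * a \in M.
  by move=> /MP aM; apply/MP => r; rewrite mulrA.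
have MD a b : a \in M -> b \in M -> a + b \in M.
  move=> aM bM; apply/MP => t; apply/negP => pP.
  have /MP taM := MZ t _ aM; have /MP tbM := MZ t _ bM.
  (* Here [p] is the element supposed to lie in [P], and [t * a + p] and [t * b] sum to 1. By
     primality one of the two factors is in [P]: the second is excluded by [b \in M], and the first
     differs from [1 - r * (t * a)] by a multiple of [p]. *)
  pose p := 1 - t * (a + b).
  have [|r [s rs0]] := @contessa (t * a + p) (t * b); first by rewrite /p; ring.
  have : (1 - r * (t * a + p)) * (1 - s * (t * b)) \in P.
    by rewrite rs0; case: Pideal.
  case/primeP/orP => [rP|]; last by apply/negP.
  have := taM r; have -> : 1 - r * (t * a) = (1 - r * (t * a + p)) + r * p by ring.
  by rewrite idealr_closedD// idealr_closedMl.
have idM : idealr_closed M.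
  split.
  - by apply: PM; case: Pideal.
  - by apply/negP => /MP/(_ 1); rewrite mulr1 subrr; case: Pideal => ->.
  - by move=> x a b aM bM; exact: MD (MZ _ _ aM) bM.
(* [M] is the largest proper ideal over [P], which gives both its maximality and its uniqueness. *)
have subM J : idealr_closed J -> {subset P <= J} -> {subset J <= M}.
  move=> idJ PJ a aJ; apply/MP => r; apply/negP => /PJ.
  by move=> /(idealr_closed_sub1F idJ aJ).
have maxM : maximal_ideal M.
  split=> // J idJ MJ a; apply/idP/idP; last exact: MJ.
  by apply: subM => // b /PM/MJ.
exists M; split=> // N [[idN maxN] PN]; apply/funext => a.
exact: (maxN M idM (subM N idN PN) a).
Qed.

End Contessa.

(** * I-convergence as convergence along a filter *)

Section IdealLimits.
Variables (R : realType) (I : set_system nat) (admI : admissible I).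

(** Limits along this filter are the I-limits, so uniqueness and the rules for sums, products and
    inverses follow from those for filters. *)
Definition dual_filter : set_system nat := [set X | I (~` X)].

Lemma dual_filter_proper : ProperFilter dual_filter.
Proof.
have [[_ idealS idealU] IN Ifin] := admI.
split; first by rewrite /dual_filter /= setC0.
split; rewrite /dual_filter /=.
- by rewrite setCT; exact: Ifin (finite_set0 _).
- by move=> X Y XI YI; rewrite /= setCI; exact: idealU.
- by move=> X Y /subsetC XY; exact: idealS.
Qed.

#[local] Existing Instance dual_filter_proper.

Lemma ideal_cvg_toE (x : nat -> R) (l : R) :
  ideal_cvg_to I x l <-> x @ dual_filter --> l.
Proof.
have E (e : R) : ~` [set n | `|l - x n| < e] = [set n | e <= `|x n - l|].
  by apply/seteqP; split=> n /=; rewrite distrC leNgt => /negP.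
split=> [xl|/cvgrPdist_lt xl e e0]; last by rewrite -E; exact: xl.
apply/cvgrPdist_lt => e e0; suff : I (~` [set n | `|l - x n| < e]) by [].
by rewrite E; exact: xl.
Qed.

Lemma ideal_cvg_to_unique (x : nat -> R) (l m : R) :
  ideal_cvg_to I x l -> ideal_cvg_to I x m -> l = m.
Proof. by move=> /ideal_cvg_toE xl /ideal_cvg_toE; exact: cvg_unique. Qed.

Lemma ideal_cvg_to_cst (l : R) : ideal_cvg_to I (fun=> l) l.
Proof. by apply/ideal_cvg_toE; exact: cvg_cst. Qed.

Lemma ideal_cvg_toD (x y : nat -> R) (l m : R) :
  ideal_cvg_to I x l -> ideal_cvg_to I y m ->
  ideal_cvg_to I (fun n => x n + y n) (l + m).
Proof. by rewrite !ideal_cvg_toE; exact: cvgD. Qed.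

Lemma ideal_cvg_toM (x y : nat -> R) (l m : R) :
  ideal_cvg_to I x l -> ideal_cvg_to I y m ->
  ideal_cvg_to I (fun n => x n * y n) (l * m).
Proof. by rewrite !ideal_cvg_toE; exact: cvgM. Qed.

(** Inverses of zero terms are 0 by convention; since [l != 0], such terms occur only on a set of
    [I] and do not affect the limit. *)
Lemma ideal_cvg_toV (x : nat -> R) (l : R) : l != 0 ->
  ideal_cvg_to I x l -> ideal_cvg_to I (fun n => (x n)^-1) l^-1.
Proof. by rewrite !ideal_cvg_toE; exact: cvgV. Qed.

Lemma ideal_cvg_to_near (x : nat -> R) (l : R) :
  I [set n | x n <> l] -> ideal_cvg_to I x l.
Proof.
move=> xl e e0; apply: (set_idealS (admissible_ideal admI)) xl => n /= + xnl.
by rewrite xnl subrr normr0 leNgt e0.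
Qed.

(** * The ring of I-convergent sequences and its pm property *)

Local Notation A := (ideal_cvg_seq R admI).

Lemma ideal_cvg_seq_lim (x : A) : exists l, ideal_cvg_to I x l.
Proof. by case: x => x xI; have /asboolP := xI. Qed.

Lemma ideal_cvg_seqP (x : nat -> R) (l : R) :
  ideal_cvg_to I x l -> exists y : A, y = x :> (nat -> R).
Proof.
move=> xl; have xA : x \in ideal_cvg_pred I by apply/asboolP; exists l.
by exists (IdealCvgSeq admI xA).
Qed.

Lemma ideal_cvg_seq_eq (x y : A) : (forall n, x n = y n) -> x = y.
Proof. by move=> xy; apply/val_inj/funext. Qed.

Lemma ideal_cvg_seqB (x y : A) n : (x - y) n = x n - y n.
Proof. by []. Qed.

Lemma ideal_cvg_seq0 n : (0 : A) n = 0.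
Proof. by []. Qed.

(** Supplies an element whose only zero point is the index [k], the extra point being excluded by
    the limit 1. *)
Lemma ideal_cvg_seq_indicN k :
  exists x : A, ideal_cvg_to I x 1 /\ forall n, x n = (n != k)%:R.
Proof.
have x1 : ideal_cvg_to I (fun n => (n != k)%:R : R) 1.
  apply: ideal_cvg_to_near; apply: (admissible_finite admI).
  apply: sub_finite_set (finite_set1 k) => n /=.
  by case: eqP.
have [x xE] := ideal_cvg_seqP x1.
by exists x; rewrite xE.
Qed.

(** Zeros of [x] are at distance [|l|] from the limit, so they form a set of [I]. *)
Lemma ideal_cvg_seq_indic_zero (x : A) l : l != 0 -> ideal_cvg_to I x l ->
  exists y : A, ideal_cvg_to I y 0 /\ forall n, y n = (x n == 0)%:R.
Proof.
move=> l0 xl.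
have y0 : ideal_cvg_to I (fun n => (x n == 0)%:R : R) 0.
  have l1 : 0 < `|l| by rewrite normr_gt0.
  apply: ideal_cvg_to_near.
  apply: (set_idealS (admissible_ideal admI)) (xl _ l1).
  by move=> n /=; case: eqP => //= ->; rewrite sub0r normrN.
have [y yE] := ideal_cvg_seqP y0.
by exists y; rewrite yE.
Qed.

Lemma ideal_cvg_seq_contessa_neq0 (a b : A) (l : R) :
  a + b = 1 -> l != 0 -> ideal_cvg_to I a l ->
  exists r s : A, (1 - r * a) * (1 - s * b) = 0.
Proof.
move=> ab1 l0 al; have [r rE] := ideal_cvg_seqP (ideal_cvg_toV l0 al).
exists r, (1 - r * a); apply: ideal_cvg_seq_eq => n.
have /(congr1 (fun x : A => x n)) := ab1.
rewrite ideal_cvg_seqD ideal_cvg_seqM !ideal_cvg_seqB !ideal_cvg_seqM.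
rewrite ideal_cvg_seqB ideal_cvg_seqM ideal_cvg_seq1 ideal_cvg_seq0 rE.
(* Where [a n] is 0, both [b n] and the term of [1 - r * a] are 1, so the second factor vanishes;
   elsewhere [r n * a n] is 1 and the first one does. *)
have [->|an0 _] := eqVneq (a n) 0; last by rewrite mulVf// subrr mul0r.
by rewrite add0r => ->; rewrite mulr0 subr0 !mul1r subrr.
Qed.

Lemma ideal_cvg_seq_pm_ring : pm_ring A.
Proof.
apply: contessa_pm_ring => a b ab1.
have [l al] := ideal_cvg_seq_lim a; have [m bm] := ideal_cvg_seq_lim b.
have [l0|l0] := eqVneq l 0; last exact: ideal_cvg_seq_contessa_neq0 ab1 l0 al.
have m0 : m != 0.
  have := ideal_cvg_toD al bm.
  have -> : (fun n => a n + b n) = (fun=> 1).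
    by apply/funext => n; rewrite -ideal_cvg_seqD ab1.
  move=> /(ideal_cvg_to_unique (ideal_cvg_to_cst 1)).
  by rewrite l0 add0r => <-; exact: oner_neq0.
rewrite addrC in ab1.
have [r [s rs]] := ideal_cvg_seq_contessa_neq0 ab1 m0 bm.
by exists s, r; rewrite mulrC.
Qed.

(** * The zero-point map and the axioms of a transition map *)

Definition zero_points (a : A) : set (option nat) :=
  [set p | if p is Some n then a n = 0 else ideal_cvg_to I a 0].

(** Terms and limits are both multiplicative, and a product of reals vanishes only if a factor
    does. *)
Lemma zero_pointsM (a b : A) :
  zero_points (a * b) = zero_points a `|` zero_points b.
Proof.
have [l al] := ideal_cvg_seq_lim a; have [m bm] := ideal_cvg_seq_lim b.
have ab : ideal_cvg_to I (a * b : A) (l * m) by exact: ideal_cvg_toM al bm.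
apply/seteqP; split=> -[n|].
- move=> abn; have /eqP := abn; rewrite ideal_cvg_seqM mulf_eq0.
  by move=> /orP[]/eqP; [left|right].
- move=> /(ideal_cvg_to_unique ab)/eqP; rewrite mulf_eq0.
  by move=> /orP[]/eqP lm0; [left|right]; rewrite /zero_points /= -lm0.
- by move=> -[] abn; rewrite /zero_points /mkset ideal_cvg_seqM abn (mul0r, mulr0).
- move=> [/(ideal_cvg_to_unique al) l0|/(ideal_cvg_to_unique bm) m0].
  + by rewrite l0 mul0r in ab.
  + by rewrite m0 mulr0 in ab.
Qed.

(** A sum of two real squares vanishes only if both do; this applies to the terms and to the limits
    alike. *)
Lemma zero_points_sumsq (a b : A) :
  zero_points (a * a + b * b) = zero_points a `&` zero_points b.
Proof.
have [l al] := ideal_cvg_seq_lim a; have [m bm] := ideal_cvg_seq_lim b.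
have ab : ideal_cvg_to I (a * a + b * b : A) (l * l + m * m).
  exact: ideal_cvg_toD (ideal_cvg_toM al al) (ideal_cvg_toM bm bm).
have sumsq0 (x y : R) : x * x + y * y = 0 -> x = 0 /\ y = 0.
  move=> /eqP; rewrite -!expr2 paddr_eq0 ?sqr_ge0// !sqrf_eq0.
  by move=> /andP[/eqP -> /eqP ->].
apply/seteqP; split=> -[n|].
- exact: sumsq0.
- move=> /(ideal_cvg_to_unique ab)/sumsq0[l0 m0].
  by rewrite l0 in al; rewrite m0 in bm.
- move=> [an bn]; rewrite /zero_points /mkset ideal_cvg_seqD !ideal_cvg_seqM.
  by rewrite an bn mul0r addr0.
- move=> [/(ideal_cvg_to_unique al) l0 /(ideal_cvg_to_unique bm) m0].
  by rewrite l0 m0 !mul0r addr0 in ab.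
Qed.

Lemma zero_pointsD (a b : A) :
  zero_points a `&` zero_points b `<=` zero_points (a + b).
Proof.
move=> [n|] [].
- by move=> an bn; rewrite /zero_points /mkset ideal_cvg_seqD an bn addr0.
- by move=> a0 b0; have := ideal_cvg_toD a0 b0; rewrite addr0.
Qed.

(** The termwise inverse converges because [None] is not a zero point, and it inverts every term
    because no [Some n] is one. *)
Lemma zero_points_unit (a : A) : zero_points a = set0 -> exists u, u * a = 1.
Proof.
move=> a0; have [l al] := ideal_cvg_seq_lim a.
have l0 : l != 0.
  by apply/eqP => l0; rewrite l0 in al; have : zero_points a None by []; rewrite a0.
have [u uE] := ideal_cvg_seqP (ideal_cvg_toV l0 al).
exists u; apply: ideal_cvg_seq_eq => n.
rewrite ideal_cvg_seqM uE mulVf//; apply/eqP => an0.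
by have : zero_points a (Some n) by []; rewrite a0.
Qed.

Lemma zero_points_semi_transition : semi_transition_map zero_points.
Proof.
split.
- by exists None.
- exact: zero_pointsM.
- apply/seteqP; split=> -[n|] //=.
  + by move/eqP; rewrite oner_eq0.
  + move=> /(ideal_cvg_to_unique (ideal_cvg_to_cst 1))/eqP.
    by rewrite oner_eq0.
- move=> a; split=> [aT|->].
    by apply: ideal_cvg_seq_eq => n; have : zero_points a (Some n) by rewrite aT.
  by apply/seteqP; split=> -[n|] //= _; exact: ideal_cvg_to_cst.
- move=> a b; exists (a * a + b * b); rewrite zero_points_sumsq; split=> //.
    by exists a, b.
  exact: zero_pointsD.
- move=> a b; rewrite -zero_points_sumsq => /zero_points_unit[u uab].
  (* As [a * a + b * b] is a unit, [a] and [b] already generate the whole ring, which is principal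
     with generator 1. *)
  exists 1%N, 1%N; split=> //; exists 1; apply/seteqP; split=> x /=.
    by move=> _; exists x => //; rewrite mulr1.
  move=> _; exists (x * u * a), (x * u * b).
  by rewrite !expr1 -!mulrA -!mulrDr uab mulr1.
Qed.

Lemma zero_points_separated (p q : option nat) : p <> q -> exists a,
  (zero_points a p /\ ~ zero_points a q) \/ (~ zero_points a p /\ zero_points a q).
Proof.
(* Of two distinct points at least one is an index, so separating an index from any other point
   suffices. *)
have sep k r : Some k <> r -> exists a, zero_points a (Some k) /\ ~ zero_points a r.
  move=> kr; have [a [a1 aE]] := ideal_cvg_seq_indicN k.
  exists a; split; first by rewrite /zero_points /= aE eqxx.
  case: r kr => [n kn|_] /=.
    by rewrite aE; case: eqP => [nk|_ /eqP]; [case: kn; rewrite nk|rewrite oner_eq0].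
  by move=> /(ideal_cvg_to_unique a1)/eqP; rewrite oner_eq0.
case: p q => [k|] [n|]// pq.
- by have [a ?] := sep _ _ pq; exists a; left.
- by have [a ?] := sep _ _ pq; exists a; left.
- by have [|a [? ?]] := sep n None; [|exists a; right].
Qed.

Lemma zero_points_disjoint (p : option nat) (a : A) : ~ zero_points a p ->
  exists b, zero_points b p /\ zero_points a `&` zero_points b = set0.
Proof.
case: p => [k ak|a0].
  have [b [b1 bE]] := ideal_cvg_seq_indicN k.
  exists b; split; first by rewrite /zero_points /= bE eqxx.
  apply/seteqP; split=> -[n|] //= [].
    by rewrite bE; case: eqP => [-> //|_ _ /eqP]; rewrite oner_eq0.
  by move=> _ /(ideal_cvg_to_unique b1)/eqP; rewrite oner_eq0.
have [l al] := ideal_cvg_seq_lim a.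
have l0 : l != 0 by apply/eqP => l0; apply: a0; rewrite l0 in al.
(* The indicator of the zeros of [a] tends to 0 but equals 1 wherever [a] vanishes. *)
have [b [b0 bE]] := ideal_cvg_seq_indic_zero l0 al.
exists b; split=> //; apply/seteqP; split=> -[n|] //= [] //.
by rewrite bE => -> /eqP; rewrite eqxx oner_eq0.
Qed.

End IdealLimits.

Theorem theorem6p3 (R : realType) (I : set_system nat) (admI : admissible I) :
  transitional (ideal_cvg_seq R admI).
Proof.
split; first exact: ideal_cvg_seq_pm_ring.
exists (option nat), (@zero_points R I admI); split.
- exact: ideal_cvg_seq_pm_ring.
- exact: zero_points_semi_transition.
- exact: zero_points_separated.
- exact: zero_points_disjoint.
Qed.
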